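(* Let $d$ be a positive integer and let $s=\frac{3^{d+1}-1}{2}$. Then, for every group $G$ and every $\ell\ge 2$, there is no reduced $(v,k,\lambda,n;\ell)$-linking system of difference sets in $G$ with Spence parameters $$(v,k,\lambda,n)=\left(3^{d+1}s,\ 3^d(s+1),\ 3^d(s+1-3^d),\ 3^{2d}\right)$$ in which two of the difference sets are of Spence type.
   Context: Groups are written multiplicatively and are not assumed abelian. For a group $G$ of order $v$, a subset $D\subseteq G$ with $k$ elements is a $(v,k,\lambda,n)$-difference set in $G$ if the multiset $\{d_1d_2^{-1} : d_1,d_2\in D,\ d_1\neq d_2\}$ contains every non-identity element of $G$ exactly $\lambda$ times, where $n:=k-\lambda$. A subset $S$ of $G$ is identified with the element $\sum_{s\in S}s$ of the group ring $\mathbb{Z}[G]$, and $S^{(-1)}:=\sum_{s\in S}s^{-1}$. For $\ell\ge 2$, a collection $\{D_1,\dots,D_\ell\}$ of size $\ell$ of $(v,k,\lambda,n)$-difference sets in $G$ is a reduced $(v,k,\lambda,n;\ell)$-linking system of difference sets in $G$ if there are integers $\mu,\nu$ such that for all distinct $i,j$ there is some $(v,k,\lambda,n)$-difference set $D(i,j)$ in $G$ (not necessarily one of the $D_r$) with $D_iD_j^{(-1)}=(\mu-\nu)D(i,j)+\nu G$ in $\mathbb{Z}[G]$. A subset $D$ of a group $G$ is of Spence type (constructed by Spence's method) if there are: a central subgroup $E$ of $G$ of index $s$ isomorphic to $\mathbb{Z}_3^{d+1}$; a set $g_1,\dots,g_s$ of coset representatives for $E$ in $G$ (one from each coset); and a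 labelling $H_1,\dots,H_s$ of the subgroups of $E$ corresponding to the hyperplanes ($d$-dimensional subspaces) of $E$, regarded as a vector space of dimension $d+1$ over $\mathrm{GF}(3)$; such that $D=g_1(E-H_1)+\sum_{i=2}^s g_iH_i$ in $\mathbb{Z}[G]$. Any such $D$ is a difference set in $G$ with the Spence parameters above. Different difference sets in the system may use different choices of these data. *)

(* Defs.v *)
(* Mathematical Components *)
From HB Require Import structures.
From mathcomp Require Import all_boot all_order all_fingroup all_algebra.
From mathcomp Require Import center.

Set Implicit Arguments.
Unset Strict Implicit.
Unset Printing Implicit Defensive.

Import GRing.Theory.
Local Open Scope ring_scope.

(* The integral group ring Z[gT], as coefficient functions under convolution.
   For G : {group gT}, Z[G] is the subring of functions supported on G. *)
Definition zgring (gT : finGroupType) := {ffun gT -> int}.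

Section ZGroupRing.
Variable gT : finGroupType.
Implicit Types (a b c : zgring gT) (x y : gT) (S : {set gT}).

HB.instance Definition _ := GRing.Zmodule.on (zgring gT).

Definition zgring_elt x : zgring gT := [ffun y => (y == x)%:R].

Definition zgring_mul a b : zgring gT :=
  [ffun x => \sum_(y : gT) a y * b (y^-1 * x)%g].

Fact zgring_mulA : associative zgring_mul.
Proof.
move=> a b c; apply/ffunP=> x; rewrite !ffunE.
under eq_bigr => y _ do rewrite ffunE big_distrr /=.
under [RHS]eq_bigr => y _ do rewrite ffunE big_distrl /=.
rewrite [RHS]exchange_big /=; apply: eq_bigr => y _.
rewrite [RHS](reindex_inj (mulgI y)) /=; apply: eq_bigr => z _.
by rewrite mulKg invMg -mulgA mulrA.
Qed.

Fact zgring_mul1 : left_id (zgring_elt 1%g) zgring_mul.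
Proof.
move=> a; apply/ffunP=> x; rewrite ffunE (bigD1 1%g) //= big1 => [|y /negPf ny].
  by rewrite ffunE eqxx mul1r invg1 mul1g addr0.
by rewrite ffunE ny mul0r.
Qed.

Fact zgring_mulr1 : right_id (zgring_elt 1%g) zgring_mul.
Proof.
move=> a; apply/ffunP=> x; rewrite ffunE (bigD1 x) //= big1 => [|y ny].
  by rewrite ffunE mulVg eqxx mulr1 addr0.
by rewrite ffunE -eq_mulVg1 (negPf ny) mulr0.
Qed.

Fact zgring_mulDl : left_distributive zgring_mul +%R.
Proof.
move=> a b c; apply/ffunP=> x; rewrite !ffunE -big_split /=.
by apply: eq_bigr => y _; rewrite ffunE mulrDl.
Qed.

Fact zgring_mulDr : right_distributive zgring_mul +%R.
Proof.
move=> a b c; apply/ffunP=> x; rewrite !ffunE -big_split /=.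
by apply: eq_bigr => y _; rewrite ffunE mulrDr.
Qed.

Fact zgring_oner_neq0 : zgring_elt 1%g != 0.
Proof. by apply/eqP=> /ffunP/(_ 1%g); rewrite !ffunE eqxx. Qed.

HB.instance Definition _ := GRing.Zmodule_isNzRing.Build (zgring gT)
  zgring_mulA zgring_mul1 zgring_mulr1 zgring_mulDl zgring_mulDr
  zgring_oner_neq0.

Definition zgring_set S : zgring gT := \sum_(x in S) zgring_elt x.

Definition zgring_setV S : zgring gT := \sum_(x in S) zgring_elt (x^-1)%g.

End ZGroupRing.

(* The relation n := k - lam is written additively, which avoids truncated
   subtraction. *)
Definition difference_set (gT : finGroupType) (G : {group gT})
    (v k lam n : nat) (D : {set gT}) : Prop :=
  [/\ #|G| = v, D \subset G, #|D| = k, k = (lam + n)%N &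
      forall x, x \in G -> x != 1%g ->
        #|[set p in setX D D | (p.1 != p.2) && (p.1 * p.2^-1 == x)%g]| = lam].

(* Injectivity of D expresses that the collection {D_1, ..., D_l} has size l. *)
Definition reduced_linking_system (gT : finGroupType) (G : {group gT})
    (v k lam n l : nat) (D : 'I_l -> {set gT}) : Prop :=
  [/\ (2 <= l)%N, injective D,
      forall i, difference_set G v k lam n (D i) &
      exists mu nu : int, forall i j : 'I_l, i != j ->
        exists2 Dij : {set gT}, difference_set G v k lam n Dij &
          zgring_set (D i) * zgring_setV (D j)
            = zgring_set Dij *~ (mu - nu) + zgring_set G *~ nu].

(* The vector space structure on E is transported along an isomorphism f from
   E to GF(3)^(d+1); as GF(3) is a prime field, it does not depend on f.  The
   hyperplane labelled H_(i+1) in the 1-based notation is the preimage under f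
   of W i, so that the index 0 : 'I_s carries the exceptional coset. *)
Definition spence_type (gT : finGroupType) (G : {group gT}) (d s : nat)
    (D : {set gT}) : Prop :=
  exists (E : {group gT}) (f : {morphism E >-> 'rV['F_3]_d.+1})
         (g : 'I_s -> gT) (W : 'I_s -> {vspace 'rV['F_3]_d.+1}),
    let H i : {set gT} := (f @*^-1 [set u | u \in W i])%g in
    [/\ E \subset 'Z(G)%g /\ #|G : E|%g = s,
        isom E [set: 'rV['F_3]_d.+1] f,
        (forall i, g i \in G) /\
          (forall C, C \in lcosets E G -> exists! i, g i \in C),
        injective W /\ (forall U, \dim U = d <-> exists i, W i = U) &
        zgring_set D = \sum_(i < s)
          (if val i == 0%N
           then zgring_elt (g i) * (zgring_set E - zgring_set (H i))
           else zgring_elt (g i) * zgring_set (H i))].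

(* Main.v *)
Require Import Defs.
From mathcomp Require Import all_boot all_order all_fingroup all_algebra.
From mathcomp Require Import center pgroup finfield zify ring.

Set Implicit Arguments.
Unset Strict Implicit.
Unset Printing Implicit Defensive.

(** Write E for the central subgroup of index s, H_1, ..., H_s for its
subgroups of order q = 3^d, and put T_i = 3 H_i - E and F = 3q - E in Z[G].
Up to the factor 3q the T_i are orthogonal central idempotents: T_i T_i = 3q T_i
and T_i T_j = 0 for distinct i, j ([netTT]).  Likewise F F = 3q F ([netF_sqr]).
A set D of Spence type satisfies D F = q (sum_i c_i g_i T_i), where c_i = -1 at
the exceptional coset and c_i = 1 elsewhere ([netF_spence]).  Multiplying F by
E gives 0, so F only forgets what is constant on cosets of E.

Since s is prime to 3, E is the Sylow 3-subgroup of G, so two sets D, D' of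
Spence type in G share E and the list of the H_i.  If
D D'^(-1) = m X + nu G, where m = mu - nu and X is a difference set, then
orthogonality gives m F X = q^2 Y with Y = sum_i c_i c'_i u_i T_i and
u_i = g_i g'_i^(-1) ([net_comb_spence_mulV]).  Multiplying D F by (D F)^(-1)
yields sum_i T_i = F ([net_sum]); doing the same with m F X yields
m^2 = q^2 ([linking_coef_sqr]).  Counting with multiplicity in the linking
equation leaves only m = q, because s > 2.

Hence F X = q Y.  Adding up the coefficients of both sides over a transversal
of E in G gives |X| = q (sum_i c_i c'_i) modulo 3q ([transversal_sum_netF]).
As |X| = q (s + 1), this says s + 1 = sum_i c_i c'_i modulo 3.  But the sum is
s if the two exceptional subgroups coincide and s - 4 if they do not
([sum_net_sign]), and neither is congruent to s + 1. *)

(** * The integral group ring *)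

Section GroupRing.
Import GRing.Theory.
Local Open Scope ring_scope.
Variable gT : finGroupType.
Implicit Types (a b c : zgring gT) (x y g : gT) (S A B D : {set gT}).
Implicit Types (m : int) (G H K E : {group gT}).
Local Notation Z := (@zgring_set gT).
Local Notation e := (@zgring_elt gT).

Lemma zgring_setE S x : Z S x = (x \in S)%:R.
Proof.
rewrite /zgring_set sum_ffunE.
case: (boolP (x \in S)) => Sx.
  rewrite (bigD1 x) //= ffunE eqxx big1 ?addr0 // => y /andP[_ /negPf nyx].
  by rewrite ffunE eq_sym nyx.
rewrite big1 // => y Sy; rewrite ffunE; case: eqP => // exy.
by rewrite exy Sy in Sx.
Qed.

Lemma zgring_setVE S x : zgring_setV S x = (x^-1 \in S)%g%:R.
Proof.
rewrite -zgring_setE /zgring_setV /zgring_set !sum_ffunE.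
by apply: eq_bigr => y _; rewrite !ffunE -(inj_eq invg_inj) invgK.
Qed.

Lemma zgring_eltMl g a x : (e g * a) x = a (g^-1 * x)%g.
Proof.
rewrite ffunE (bigD1 g) //= ffunE eqxx mul1r big1 ?addr0 // => y /negPf ny.
by rewrite ffunE ny mul0r.
Qed.

Lemma zgring_eltMr g a x : (a * e g) x = a (x * g^-1)%g.
Proof.
rewrite ffunE (bigD1 (x * g^-1)%g) //= ffunE invMg invgK mulgKV eqxx mulr1.
rewrite big1 ?addr0 // => y ny; rewrite ffunE; case: eqP => [yx|]; last by rewrite mulr0.
by rewrite -yx invMg invgK mulKVg eqxx in ny.
Qed.

Lemma zgring_eltM x y : e x * e y = e (x * y)%g.
Proof.
apply/ffunP=> z; rewrite zgring_eltMl !ffunE.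
by rewrite -(inj_eq (mulgI x)) mulKVg.
Qed.

(** Z[gT] is torsion-free, which is what allows dividing by group orders. *)
Lemma zgring_mulrzI m a b : m != 0 -> a *~ m = b *~ m -> a = b.
Proof.
move=> m0 /ffunP eab; apply/ffunP=> x; move: (eab x); rewrite !ffunMzE.
by rewrite !mulrzz; apply: (mulIf m0).
Qed.

(** The anti-automorphism usually written a^(-1), extending S |-> S^(-1) from
sets to all of Z[gT]. *)
Definition zgring_inv a : zgring gT := [ffun x => a x^-1%g].
Local Notation inv := zgring_inv.

Lemma zgring_invM a b : inv (a * b) = inv b * inv a.
Proof.
apply/ffunP=> x; rewrite !ffunE [RHS](reindex_inj (mulgI x)) /=.
by apply: eq_bigr => y _; rewrite !ffunE !invMg !invgK mulKg mulrC.
Qed.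

Lemma zgring_invMz a m : inv (a *~ m) = inv a *~ m.
Proof. by apply/ffunP=> x; rewrite !(ffunMzE, ffunE). Qed.

Lemma zgring_invB a b : inv (a - b) = inv a - inv b.
Proof. by apply/ffunP=> x; rewrite !ffunE. Qed.

Lemma zgring_inv_sum (I : finType) (f : I -> zgring gT) :
  inv (\sum_i f i) = \sum_i inv (f i).
Proof.
by apply/ffunP=> x; rewrite ffunE !sum_ffunE; apply: eq_bigr => i _; rewrite ffunE.
Qed.

Lemma zgring_inv_elt x : inv (e x) = e x^-1%g.
Proof. by apply/ffunP=> y; rewrite !ffunE -(inj_eq invg_inj) invgK. Qed.

Lemma zgring_inv_set S : inv (Z S) = zgring_setV S.
Proof. by apply/ffunP=> x; rewrite ffunE zgring_setE zgring_setVE. Qed.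

Lemma zgring_inv_group H : inv (Z H) = Z H.
Proof. by apply/ffunP=> x; rewrite ffunE !zgring_setE groupV. Qed.

Lemma zgring_group_eltr H x : x \in H -> Z H * e x = Z H.
Proof.
move=> Hx; apply/ffunP=> y.
by rewrite zgring_eltMr !zgring_setE groupMr ?groupV.
Qed.

Lemma zgring_group_eltl H x : x \in H -> e x * Z H = Z H.
Proof.
move=> Hx; apply/ffunP=> y.
by rewrite zgring_eltMl !zgring_setE groupMl ?groupV.
Qed.

Lemma zgring_absorbr a S :
  {in S, forall x, a * e x = a} -> a * Z S = a *~ #|S|.
Proof.
move=> aS; rewrite /zgring_set mulr_sumr (eq_bigr (fun=> a)) //.
by rewrite sumr_const.
Qed.

Lemma zgring_absorbl a S :
  {in S, forall x, e x * a = a} -> Z S * a = a *~ #|S|.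
Proof.
move=> aS; rewrite /zgring_set mulr_suml (eq_bigr (fun=> a)) //.
by rewrite sumr_const.
Qed.

Lemma zgring_setM_group S G : S \subset G -> Z S * Z G = Z G *~ #|S|.
Proof.
by move/subsetP=> sSG; apply: zgring_absorbl => x /sSG/zgring_group_eltl.
Qed.

Lemma zgring_setVM_group S G : S \subset G -> zgring_setV S * Z G = Z G *~ #|S|.
Proof.
move=> sSG; rewrite -zgring_inv_set -{1}(zgring_inv_group G) -zgring_invM.
rewrite (@zgring_absorbr (Z G)) ?zgring_invMz ?zgring_inv_group // => x Sx.
by rewrite zgring_group_eltr ?(subsetP sSG).
Qed.

Lemma zgring_comm_set a S G : (forall x, x \in G -> a * e x = e x * a) ->
  S \subset G -> a * Z S = Z S * a.
Proof.
move=> ca /subsetP sSG; apply: commr_sum => x /sSG; apply: ca.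
Qed.

(** A central set need not be central in Z[gT], only in the subring Z[G], since
G may be a proper subgroup of gT. *)
Lemma zgring_comm_central S G x :
  S \subset 'Z(G)%g -> x \in G -> Z S * e x = e x * Z S.
Proof.
move=> /subsetP sSZ Gx; rewrite /zgring_set mulr_suml mulr_sumr.
apply: eq_bigr => y /sSZ /centerP[_ cy]; rewrite !zgring_eltM.
by rewrite (cy x Gx).
Qed.

(** The group ring form of the difference set axioms: the pairs (d, d) produce
the coefficient k = lam + n at the identity. *)
Lemma difference_set_mulV G v k lam n D : difference_set G v k lam n D ->
  Z D * zgring_setV D = 1 *~ n + Z G *~ lam.
Proof.
case=> oG sDG oD kE dD; apply/ffunP=> x.
set Dx := [set p in setX D D | (p.1 * p.2^-1 == x)%g].
have -> : (Z D * zgring_setV D) x = #|Dx|%:R.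
  (* A pair with quotient x is determined by its first component. *)
  have -> : Dx = [set (y, x^-1 * y)%g | y in [set y in D | (x^-1 * y)%g \in D]].
    apply/setP=> -[y z]; rewrite !inE /=; apply/idP/imsetP => [|[w]].
      case/andP=> /andP[Dy Dz] /eqP<-.
      by exists y; rewrite ?inE invMg invgK mulgKV ?Dy.
    by rewrite inE => /andP[Dw Dz] [-> ->]; rewrite Dw Dz invMg invgK mulKVg /=.
  rewrite card_imset => [|y z [//]].
  rewrite -sum1dep_card natr_sum big_mkcond ffunE; apply: eq_bigr => y _ /=.
  rewrite zgring_setE zgring_setVE invMg invgK.
  by case: (y \in D) => /=; case: (_ \in D).
rewrite !ffunE !ffunMzE zgring_setE ffunE.
have [x1|nx] := eqVneq x 1%g.
  rewrite x1 group1.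
  have -> : Dx = [set (y, y) | y in D].
    apply/setP=> -[y z]; rewrite !inE /= x1 -eq_mulgV1; apply/idP/imsetP.
      by case/andP=> /andP[Dy Dz] /eqP eyz; exists y; rewrite // eyz.
    by case=> w Dw [-> ->]; rewrite Dw eqxx.
  by rewrite card_imset => [|y z [//]]; lia.
case: (boolP (x \in G)) => Gx.
  rewrite -(dD x Gx nx) /=.
  have -> : Dx = [set p in setX D D | (p.1 != p.2) && (p.1 * p.2^-1 == x)%g].
    apply/setP=> -[y z]; rewrite !inE /=; congr (_ && _).
    by case: eqP => [xE|]; rewrite ?andbF // andbT eq_mulgV1 xE nx.
  by rewrite mul0rz add0r -pmulrn.
suff -> : Dx = set0 by rewrite cards0 !mul0rz addr0.
apply/setP=> -[y z]; rewrite !inE /=; apply/negP=> /andP[/andP[Dy Dz] /eqP xE].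
by rewrite -xE groupM ?groupV ?(subsetP sDG) in Gx.
Qed.
End GroupRing.

(** * Sign patterns with one exceptional index *)

Section Signs.
Import GRing.Theory.
Local Open Scope ring_scope.
Variable I : finType.

(** The signs of a Spence difference set: only the exceptional coset carries
E - H_i, which is -H_i up to multiples of E. *)
Definition net_sign (i0 i : I) : int := if i == i0 then -1 else 1.

Lemma net_sign_sqr i0 i : net_sign i0 i * net_sign i0 i = 1.
Proof. by rewrite /net_sign; case: (i == i0); rewrite ?mulrNN mulr1. Qed.

(** Each exceptional index flips one sign; the flips cancel if the indices
coincide (t = 0) and cost 2 each otherwise (t = 1). *)
Lemma sum_net_sign i0 i0' : exists2 t : int, (t = 0) \/ (t = 1) &
  \sum_i net_sign i0 i * net_sign i0' i = #|I|%:Z - 4 * t.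
Proof.
have sgnE j i : net_sign j i = 1 - 2 * (i == j)%:Z.
  by rewrite /net_sign; case: eqP.
exists (i0 != i0')%:Z; first by case: eqP; auto.
(* Expand (1 - 2 [i = i0]) (1 - 2 [i = i0']). *)
rewrite (eq_bigr (fun i => 1 - 2 * (i == i0)%:Z - 2 * (i == i0')%:Z
   + 4 * ((i == i0) && (i == i0'))%:Z)); last first.
  by move=> i _; rewrite !sgnE; case: (i == i0); case: (i == i0').
rewrite !(big_split, sumrN) /= -!mulr_sumr.
have -> : \sum_(i : I) (1 : int) = #|I|%:Z by rewrite sumr_const natz.
have one j : \sum_i (i == j)%:Z = 1.
  by rewrite (bigD1 j) //= eqxx big1 ?addr0 // => i /negPf ->.
have both : \sum_i ((i == i0) && (i == i0'))%:Z = (i0 == i0')%:Z.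
  rewrite (bigD1 i0) //= eqxx big1 ?addr0 // => i /negPf ->; exact: erefl.
by rewrite !one both; case: eqP => _ /=; lia.
Qed.

End Signs.

(** * Subgroups of index 3 in a central subgroup *)

Section Net.
Import GRing.Theory.
Local Open Scope ring_scope.
Variables (gT : finGroupType) (G E : {group gT}) (q : nat).
Local Notation Z := (@zgring_set gT).
Local Notation e := (@zgring_elt gT).
Local Notation inv := (@zgring_inv gT).
Hypothesis sEZ : E \subset 'Z(G)%g.
Hypothesis oE : #|E| = (3 * q)%N.

Let sEG : E \subset G.
Proof. exact: subset_trans sEZ (center_sub G). Qed.

(** Index 3 is prime, so K is a maximal subgroup of the abelian group E and
K L is either K or E. *)
Lemma mul_index3_subgroups (K L : {group gT}) :
  K \subset E -> L \subset E -> #|K| = q -> #|L| = q -> K :!=: L -> (K * L)%g = E.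
Proof.
move=> sKE sLE oK oL nKL.
have cEE : abelian E.
  apply: abelianS sEZ _; exact: center_abelian.
have cKL : commute K L.
  exact/normC/cents_norm/(subset_trans sKE)/(subset_trans cEE)/centS.
have sKLE : (K <*> L \subset E)%g by rewrite join_subG sKE.
have oM : (#|K <*> L|%g %| 3 * q)%N by rewrite -oE cardSg.
have q0 : (0 < q)%N by rewrite -oK cardG_gt0.
have dM : (q %| #|K <*> L|%g)%N by rewrite -{1}oK cardSg ?joing_subl.
case/dvdnP: dM => m mE; rewrite mE dvdn_pmul2r // in oM.
rewrite -(comm_joingE cKL).
have [m1|m3] : m = 1%N \/ m = 3%N.
  by move: (oM) (dvdn_leq (isT : 0 < 3)%N oM); case: m {mE oM} => [|[|[|[|]]]] //; auto.
  case/eqP: nKL; rewrite m1 mul1n in mE.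
  have eK : K :=: (K <*> L)%g by apply/eqP; rewrite eqEcard joing_subl mE oK /=.
  have eL : L :=: (K <*> L)%g by apply/eqP; rewrite eqEcard joing_subr mE oL /=.
  by rewrite eK -eL.
by apply/eqP; rewrite eqEcard sKLE mE m3 oE /=.
Qed.

(** 3q times the idempotent complementary to the averaging idempotent of E. *)
Definition netF : zgring gT := 1 *~ (3 * q)%N - Z E.

Lemma zgring_EE : Z E * Z E = Z E *~ (3 * q)%N.
Proof. by rewrite zgring_setM_group // oE. Qed.

Lemma netF_E : netF * Z E = 0.
Proof. by rewrite mulrBl zgring_EE mulrzAl mul1r subrr. Qed.

Lemma netF_sqr : netF * netF = netF *~ (3 * q)%N.
Proof. by rewrite {2}/netF mulrBr netF_E subr0 mulrzAr mulr1. Qed.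

Lemma netF_inv : inv netF = netF.
Proof. by rewrite zgring_invB zgring_invMz zgring_inv_group zgring_inv_elt invg1. Qed.

Lemma netF_comm x : x \in G -> netF * e x = e x * netF.
Proof.
move=> Gx; rewrite mulrBl mulrBr (@zgring_comm_central _ _ G) //.
by rewrite mulrzAl mulrzAr mul1r mulr1.
Qed.

(** F kills G, so the term nu G of a linking equation disappears after
multiplication by F. *)
Lemma netF_G : netF * Z G = 0.
Proof. by rewrite mulrBl zgring_setM_group // oE mulrzAl mul1r subrr. Qed.

Variables (I : finType) (H : I -> {group gT}).
Hypothesis sHE : forall i, H i \subset E.
Hypothesis oH : forall i, #|H i| = q.
Hypothesis injH : injective H.

(** T_i is 3q times the sum of the two primitive idempotents of C[E] whose
characters have kernel H_i. *)
Definition netT i : zgring gT := Z (H i) *~ 3 - Z E.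

Lemma netT_inv i : inv (netT i) = netT i.
Proof. by rewrite zgring_invB zgring_invMz !zgring_inv_group. Qed.

Lemma netT_comm i x : x \in G -> netT i * e x = e x * netT i.
Proof.
move=> Gx; rewrite mulrBl mulrBr !mulrzAl mulrzAr.
by rewrite !(@zgring_comm_central _ _ G) // (subset_trans (sHE i)).
Qed.

Lemma netT_E i : netT i * Z E = 0.
Proof. by rewrite mulrBl mulrzAl !zgring_setM_group // oE oH -mulrzA PoszM mulrC subrr. Qed.

Lemma netT_eltr i x : x \in H i -> netT i * e x = netT i.
Proof.
by move=> Hx; rewrite mulrBl mulrzAl !zgring_group_eltr // (subsetP (sHE i)).
Qed.

(** For distinct i, j the product is invariant under H_i H_j = E, hence a
multiple of T_i E = 0. *)
Lemma netTH i j : netT i * Z (H j) = if i == j then netT i *~ q else 0.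
Proof.
have [<-|nij] := eqVneq i j.
  by rewrite zgring_absorbr ?oH // => x; apply: netT_eltr.
have q0 : (3 * q)%N%:Z != 0 by rewrite -oE; have := cardG_gt0 E; lia.
apply: (@zgring_mulrzI _ (3 * q)%N) => //; rewrite mul0rz -oE.
rewrite -(@zgring_absorbr _ (netT i * Z (H j)) E); last first.
  rewrite -(@mul_index3_subgroups (H i) (H j)) //; last first.
    by apply: contra_neq nij => /val_inj/injH.
  move=> _ /mulsgP[x y Hx Hy ->].
  have Gx : x \in G by rewrite (subsetP sEG) ?(subsetP (sHE i)).
  rewrite -zgring_eltM mulrA -(mulrA (netT i)) (@zgring_comm_central _ _ G) //.
    by rewrite mulrA netT_eltr // -mulrA zgring_group_eltr.
  exact: subset_trans (sHE j) sEZ.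
by rewrite -mulrA zgring_setM_group // mulrzAr netT_E mul0rz.
Qed.

Lemma netTT i j : netT i * netT j = if i == j then netT i *~ (3 * q)%N else 0.
Proof.
rewrite {2}/netT mulrBr netT_E subr0 mulrzAr netTH.
by case: eqP => // _; rewrite ?mul0rz // -mulrzA PoszM mulrC.
Qed.

(** A group ring element whose component at each T_i is monomial; orthogonality
makes these multiply componentwise. *)
Definition net_comb (c : I -> int) (g : I -> gT) : zgring gT :=
  \sum_i e (g i) * netT i *~ c i.

Lemma net_comb_mulV c c' g g' : (forall i, g' i \in G) ->
  net_comb c g * inv (net_comb c' g') =
  net_comb (fun i => c i * c' i) (fun i => g i * (g' i)^-1)%g *~ (3 * q)%N.
Proof.
move=> Gg'; rewrite zgring_inv_sum /net_comb mulr_suml mulrz_suml.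
apply: eq_bigr => i _; rewrite mulr_sumr (bigD1 i) //= big1 => [|j nji].
  rewrite addr0 zgring_invMz zgring_invM netT_inv zgring_inv_elt.
  rewrite mulrzAl mulrzAr -!mulrA (mulrA (netT i)) netTT eqxx mulrzAl.
  rewrite netT_comm ?groupV // mulrzAr mulrA zgring_eltM.
  by rewrite -!mulrzA; congr (_ *~ _); lia.
rewrite zgring_invMz zgring_invM netT_inv zgring_inv_elt.
rewrite mulrzAl mulrzAr -!mulrA (mulrA (netT i)) netTT eq_sym (negPf nji).
by rewrite mul0r mulr0 !mul0rz.
Qed.

(** This form of the Spence construction no longer sees the term E, because
E F = 0, while H_i F = q T_i. *)
Lemma netF_spence (D : {set gT}) (i0 : I) (g : I -> gT) :
    zgring_set D = \sum_i (if i == i0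
      then e (g i) * (Z E - Z (H i)) else e (g i) * Z (H i)) ->
  zgring_set D * netF = net_comb (net_sign i0) g *~ q.
Proof.
have HF i : Z (H i) * netF = netT i *~ q.
  rewrite mulrBr zgring_setM_group // oH mulrzAr mulr1 mulrzBl.
  by rewrite -mulrzA PoszM.
have EF : Z E * netF = 0.
  by rewrite mulrBr mulrzAr mulr1 zgring_EE subrr.
move=> ->; rewrite mulr_suml /net_comb mulrz_suml; apply: eq_bigr => i _.
rewrite /net_sign; case: eqP => _.
  by rewrite -mulrA mulrBl EF HF sub0r mulrN mulrzAr mulrNz mulr1z mulNrz.
by rewrite -mulrA HF mulrzAr.
Qed.

(** * Linking equations seen through F *)

Lemma netF_mulV (D D' : {set gT}) : D \subset G -> D' \subset G ->
  (Z D * netF) * inv (Z D' * netF) = netF * (Z D * zgring_setV D') *~ (3 * q)%N.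
Proof.
move=> sDG sD'G; rewrite zgring_invM netF_inv zgring_inv_set.
rewrite mulrA -(mulrA _ netF netF) netF_sqr mulrzAr mulrzAl.
by rewrite -(@zgring_comm_set _ netF _ G) ?mulrA //; apply: netF_comm.
Qed.

Let tq0 : (3 * q)%N%:Z != 0.
Proof. by rewrite -oE; have := cardG_gt0 E; lia. Qed.

Let q0 : q%:Z != 0.
Proof. by move: tq0; lia. Qed.

Let q2E : (q ^ 2)%N%:Z = q%:Z ^+ 2.
Proof. by rewrite -!natz natrX. Qed.

Lemma netF_difference_set v k lam n X : difference_set G v k lam n X ->
  netF * (Z X * zgring_setV X) = netF *~ n.
Proof.
move=> dX; rewrite (difference_set_mulV dX).
by rewrite mulrDr !mulrzAr netF_G mul0rz addr0 mulr1.
Qed.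

Lemma net_comb_spence_mulV (D D' : {set gT}) i0 i0' g g' :
    D \subset G -> D' \subset G -> (forall i, g' i \in G) ->
    Z D * netF = net_comb (net_sign i0) g *~ q ->
    Z D' * netF = net_comb (net_sign i0') g' *~ q ->
  netF * (Z D * zgring_setV D') =
  net_comb (fun i => net_sign i0 i * net_sign i0' i)
    (fun i => g i * (g' i)^-1)%g *~ (q%:Z ^+ 2).
Proof.
move=> sDG sD'G Gg' DF D'F; apply: (@zgring_mulrzI _ (3 * q)%N) => //.
rewrite -netF_mulV // DF D'F zgring_invMz mulrzAl mulrzAr net_comb_mulV //.
by rewrite -!mulrzA; congr (_ *~ _); lia.
Qed.

(** Both sides, multiplied by 3q^3, compute (D F) (D F)^(-1), by the difference
set property and by the componentwise product respectively.  In this way the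
number of H_i through a given element of E need not be counted. *)
Lemma net_sum v k lam (D : {set gT}) i0 g :
    difference_set G v k lam (q ^ 2) D -> (forall i, g i \in G) ->
    Z D * netF = net_comb (net_sign i0) g *~ q ->
  \sum_i netT i = netF.
Proof.
move=> dD Gg DF; have sDG : D \subset G by case: dD.
have := net_comb_spence_mulV sDG sDG Gg DF DF.
rewrite (netF_difference_set dD) q2E.
move/(zgring_mulrzI (expf_neq0 2 q0)) => ->.
apply: eq_bigr => i _.
by rewrite net_sign_sqr mulgV mul1r mulr1z.
Qed.

(** Compare m F X and its expansion, each multiplied by its own inverse: the
first gives m^2 q^2 F and the second gives q^4 F, up to the factor 3q. *)
Lemma linking_coef_sqr v k lam (X : {set gT}) (m : int) (c : I -> int) g :
    difference_set G v k lam (q ^ 2) X -> (forall i, g i \in G) ->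
    (forall i, c i * c i = 1) -> \sum_i netT i = netF ->
    netF * Z X *~ m = net_comb c g *~ (q%:Z ^+ 2) ->
  m ^+ 2 = q%:Z ^+ 2.
Proof.
move=> dX Gg c2 sumT XF; have sXG : X \subset G by case: dX.
have cX : netF * Z X = Z X * netF.
  by apply: (@zgring_comm_set _ netF _ G) => //; apply: netF_comm.
have YY : net_comb c g * inv (net_comb c g) = netF *~ (3 * q)%N.
  rewrite net_comb_mulV // -sumT; congr (_ *~ _); apply: eq_bigr => i _.
  by rewrite mulgV mul1r c2 mulr1z.
(* The coefficient at the identity suffices: that of F is 3q - 1, not 0. *)
have : (netF * Z X *~ m) * inv (netF * Z X *~ m) =
       (net_comb c g *~ (q%:Z ^+ 2)) * inv (net_comb c g *~ (q%:Z ^+ 2)).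
  by rewrite XF.
rewrite cX !zgring_invMz !mulrzAl !mulrzAr YY netF_mulV //.
rewrite (netF_difference_set dX) -!mulrzA.
move/ffunP/(_ 1%g); rewrite !ffunMzE /netF !ffunE !ffunMzE zgring_setE group1.
rewrite !ffunE eqxx /= !mulrzz.
rewrite q2E mul1r => h.
have a0 : (3 * q)%N%:Z - 1 != 0 by rewrite subr_eq0; lia.
apply: (mulfI (mulf_neq0 (mulf_neq0 a0 tq0) (expf_neq0 2 q0))).
transitivity (((3 * q)%N%:Z - 1) * (q%:Z ^+ 2 * ((3 * q)%N%:Z * (m * m)))); first by ring.
by rewrite h; ring.
Qed.

Lemma linking_augmentation (D D' X : {set gT}) (m nu : int) k :
    D \subset G -> D' \subset G -> X \subset G ->
    #|D| = k -> #|D'| = k -> #|X| = k ->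
    Z D * zgring_setV D' = Z X *~ m + Z G *~ nu ->
  k%:Z ^+ 2 = m * k + nu * #|G|.
Proof.
move=> sDG sD'G sXG oD oD' oX DD.
have : Z D * zgring_setV D' * Z G = (Z X *~ m + Z G *~ nu) * Z G by rewrite DD.
rewrite -mulrA zgring_setVM_group // mulrzAr mulrDl !mulrzAl.
rewrite !zgring_setM_group // oD oD' oX -!mulrzA.
move/ffunP/(_ 1%g); rewrite !ffunE !ffunMzE zgring_setE group1 !mulrzz !mul1r => kE.
by rewrite expr2 kE mulrC [nu * _]mulrC.
Qed.

(** A linear functional that takes the value 1 on every coset of E, so that
phi (S E) = |S| for every subset S of G. *)
Definition transversal_sum (J : finType) (r : J -> gT) (a : zgring gT) : int :=
  \sum_j a (r j).

Section Transversal.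
Variables (J : finType) (r : J -> gT).
Hypothesis rP : forall C, C \in lcosets E G -> exists! j, r j \in C.
Local Notation phi := (transversal_sum r).

Lemma transversal_sumB a b : phi (a - b) = phi a - phi b.
Proof. by rewrite -sumrB; apply: eq_bigr => j _; rewrite !ffunE. Qed.

Lemma transversal_sumMz a m : phi (a *~ m) = phi a * m.
Proof. by rewrite mulr_suml; apply: eq_bigr => j _; rewrite ffunMzE mulrzz. Qed.

Lemma transversal_sum_sum (K : finType) (P : pred K) (f : K -> zgring gT) :
  phi (\sum_(i | P i) f i) = \sum_(i | P i) phi (f i).
Proof. by rewrite exchange_big; apply: eq_bigr => j _; rewrite sum_ffunE. Qed.

Lemma transversal_sum_coset x : x \in G -> phi (e x * Z E) = 1.
Proof.
move=> Gx; have xE : (x *: E)%g \in lcosets E G by apply/lcosetsP; exists x.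
have [j [rj uj]] := rP xE.
rewrite /transversal_sum (bigD1 j) //= big1 => [|i nij].
  by rewrite zgring_eltMl zgring_setE -mem_lcoset rj.
rewrite zgring_eltMl zgring_setE -mem_lcoset; case: (boolP (_ \in _)) => // ri.
by rewrite (uj i ri) eqxx in nij.
Qed.

Lemma transversal_sum_setM (X : {set gT}) : X \subset G -> phi (Z X * Z E) = #|X|%:Z.
Proof.
move=> /subsetP sXG; rewrite {1}/zgring_set mulr_suml transversal_sum_sum.
rewrite (eq_bigr (fun=> 1)) => [|x /sXG Gx]; last by rewrite transversal_sum_coset.
by rewrite sumr_const natz.
Qed.

(** Apply the functional to F X = q Y: it sends F X to 3q phi(X) - |X|, and
each T_i-component to 3 phi(g_i H_i) - 1. *)
Lemma transversal_sum_netF (X : {set gT}) (c : I -> int) g :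
    X \subset G -> (forall i, g i \in G) ->
    netF * Z X = net_comb c g *~ q ->
  exists t : int, #|X|%:Z = q%:Z * (\sum_i c i + 3 * t).
Proof.
move=> sXG Gg XF.
have cX : netF * Z X = Z X * netF.
  by apply: (@zgring_comm_set _ netF _ G) => //; apply: netF_comm.
exists (phi (Z X) - \sum_i phi (e (g i) * Z (H i)) * c i).
have : phi (Z X * netF) = phi (net_comb c g *~ q) by rewrite -cX XF.
rewrite mulrBr mulrzAr mulr1 transversal_sumB !transversal_sumMz.
rewrite transversal_sum_setM //.
have -> : phi (net_comb c g) =
    3 * (\sum_i phi (e (g i) * Z (H i)) * c i) - \sum_i c i.
  rewrite /net_comb transversal_sum_sum mulr_sumr -sumrB; apply: eq_bigr => i _.
  rewrite transversal_sumMz /netT mulrBr mulrzAr transversal_sumB.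
  by rewrite transversal_sumMz transversal_sum_coset //; ring.
move=> XE; rewrite mulrBr mulrDr in XE *; lia.
Qed.
End Transversal.

End Net.

(** * Sets of Spence type *)

Section SpenceType.
Import GRing.Theory.
Local Open Scope ring_scope.

(** Scalars of a prime field are multiples of 1, so additive subgroups are
subspaces. *)
Lemma subgroup_vspace (p n : nat) (K : {group 'rV['F_p]_n}) :
  exists U : {vspace 'rV['F_p]_n}, forall u, (u \in U) = (u \in K).
Proof.
exists <<enum K>>%VS => u; apply/idP/idP => [|Ku]; last first.
  by rewrite memv_span ?mem_enum.
move/(@coord_span _ _ _ (in_tuple (enum K))) => ->.
apply: (big_ind (fun v => v \in K)) => [|v w Kv Kw|i _].
- exact: (group1 K).
- exact: (groupM Kv Kw).
rewrite -[coord _ _ _]natr_Zp scaler_nat; apply: (@groupX _ K).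
by rewrite -mem_enum mem_nth.
Qed.

Lemma card_vspace_F3 n (U : {vspace 'rV['F_3]_n}) :
  #|[set u | u \in U]| = (3 ^ \dim U)%N.
Proof. by rewrite cardsE card_vspace card_Fp. Qed.

Variable gT : finGroupType.
Implicit Types (G E K : {group gT}) (D : {set gT}).
Local Notation Z := (@zgring_set gT).
Local Notation e := (@zgring_elt gT).

Definition spence_sum {I : finType} E (H : I -> {group gT}) i0 (g : I -> gT) :=
  \sum_i (if i == i0 then e (g i) * (Z E - Z (H i)) else e (g i) * Z (H i)).

(** The hyperplanes are removed from the description: as f is an isomorphism,
the H_i are exactly the subgroups of order 3^d of E, a list that does not
depend on f. *)
Lemma spence_typeP G d s D : (0 < s)%N -> spence_type G d s D ->
  exists E (H : 'I_s -> {group gT}) (g : 'I_s -> gT) (i0 : 'I_s),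
    [/\ E \subset 'Z(G)%g, #|E| = (3 * 3 ^ d)%N, #|G : E|%g = s,
        (forall i, g i \in G) &
        forall C, C \in lcosets E G -> exists! i, g i \in C] /\
    [/\ injective H,
        forall K, (K \subset E /\ #|K| = (3 ^ d)%N) <-> exists i, H i = K &
        Z D = spence_sum E H i0 g].
Proof.
move=> s0 [E [f [g [W /= [[sEZ iE] isof [Gg gP] [injW dW] DE]]]]].
have [injf fE] := isomP isof.
have Wgr i : group_set [set u | u \in W i].
  apply/group_setP; split=> [|u v]; rewrite !inE; first exact: mem0v.
  exact: memvD.
pose H i := (f @*^-1 (Group (Wgr i)))%G.
have fH i : (f @* H i)%g = [set u | u \in W i].
  by rewrite morphpreK // fE subsetT.
have sHE i : H i \subset E by apply: subsetIl.
exists E, H, g, (Ordinal s0); split; split=> //.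
- by rewrite -(card_injm injf (subxx E)) fE cardsT card_mx mul1n card_Fp // expnS.
- move=> i j eH; apply: injW; apply/vspaceP=> u.
  by have := fH i; rewrite eH fH => /setP/(_ u); rewrite !inE.
- move=> K; split=> [[sKE oK]|[i <-]]; last first.
    split; first exact: sHE.
    rewrite -(card_injm injf (sHE i)) fH card_vspace_F3.
    by have /dW-> : exists j, W j = W i by exists i.
  have [U UK] := @subgroup_vspace 3 d.+1 (f @* K)%G.
  have UE : [set u | u \in U] = (f @* K)%g by apply/setP=> u; rewrite inE UK.
  have /dW[i Wi] : \dim U = d.
    by apply/eqP; rewrite -(@eqn_exp2l 3) // -card_vspace_F3 UE card_injm // oK.
  exists i; apply/val_inj/(injm_morphim_inj injf) => //=; first exact: sHE.
  by rewrite fH Wi UE.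
Qed.

(** Two labellings of the same subgroups differ by a permutation, which can be
absorbed into the coset representatives. *)
Lemma spence_sum_relabel (I : finType) E (H H' : I -> {group gT}) i0 g :
    injective H' -> (forall j, exists i, H i = H' j) ->
  exists i1 (r : I -> I), spence_sum E H' i0 g = spence_sum E H i1 (g \o r).
Proof.
move=> injH' HH'.
have /fin_all_exists[p pE] j : exists i, H i = H' j by [].
have injp : injective p by move=> i j eij; apply: injH'; rewrite -!pE eij.
exists (p i0), (invF injp); rewrite /spence_sum [RHS](reindex_inj injp) /=.
by apply: eq_bigr => j _; rewrite (inj_eq injp) invF_f pE.
Qed.

(** Both subgroups are normal Sylow p-subgroups of G. *)
Lemma central_Hall_uniq G E E' p n s : prime p -> ~~ (p %| s)%N ->
    E \subset 'Z(G)%g -> E' \subset 'Z(G)%g ->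
    #|E| = (p ^ n)%N -> #|E'| = (p ^ n)%N -> #|G : E|%g = s ->
  E' = E.
Proof.
move=> pp ps sEZ sE'Z oE oE' iE; apply/val_inj/eqP.
rewrite eqEcard oE oE' leqnn andbT.
have sEG := subset_trans sEZ (center_sub G).
rewrite (@sub_normal_Hall _ p G) ?(subset_trans sE'Z (center_sub G)) //.
- by rewrite /pgroup oE' pnatX pnat_id.
- by rewrite /pHall sEG iE /pgroup oE pnatX pnat_id //= p'natE.
- exact: sub_center_normal.
Qed.

(** This rules out mu - nu = -q: the relation would force s to divide 2q, hence
6q = 4s + 2, hence 2. *)
Lemma linking_coef_neq_opp (q s : nat) (nu : int) : (4 <= s)%N ->
    (2 * s + 1 = 3 * q)%N ->
  (q * (s + 1))%N%:Z ^+ 2 <> - q%:Z * (q * (s + 1))%N + nu * (3 * q * s)%N.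
Proof.
move=> s4 s2; rewrite !PoszM PoszD expr2 => kE.
have q0 : q%:Z != 0 by lia.
have sq : s%:Z * (3 * nu - q%:Z * (s%:Z + 3)) = 2 * q%:Z.
  apply: (mulfI q0).
  transitivity (nu * (3 * q%:Z * s%:Z) - q%:Z * q%:Z * (s%:Z * (s%:Z + 3))).
    by ring.
  have -> : nu * (3 * q%:Z * s%:Z) =
      q%:Z * (s%:Z + 1) * (q%:Z * (s%:Z + 1)) + q%:Z * (q%:Z * (s%:Z + 1)).
    by rewrite kE; ring.
  by ring.
move: (3 * nu - _) sq => w sq {kE}.
have sw : s%:Z * (3 * w - 4) = 2 by rewrite mulrBr mulrCA sq; lia.
case: (3 * w - 4) sw => [[|x]|x].
- by rewrite mulr0.
- by rewrite -PoszM mulnS; lia.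
- by rewrite NegzE mulrN -PoszM; lia.
Qed.

End SpenceType.

Theorem theorem4p5 (d s : nat) (hd : 0 < d) (hs : s = (3 ^ d.+1 - 1) %/ 2)
    (gT : finGroupType) (G : {group gT}) (l : nat) (hl : 2 <= l) :
  ~ exists D : 'I_l -> {set gT},
      reduced_linking_system G
        (3 ^ d.+1 * s) (3 ^ d * (s + 1)) (3 ^ d * (s + 1 - 3 ^ d)) (3 ^ (2 * d))
        D
      /\ exists i j : 'I_l,
           [/\ i <> j, spence_type G d s (D i) & spence_type G d s (D j)].
Proof.
case=> D [[_ _ dD [mu [nu link]]] [i [j [nij spi spj]]]].
have q3 : 3 <= 3 ^ d by rewrite -[3]/(3 ^ 1) leq_exp2l.
have s2 : 2 * s + 1 = 3 * 3 ^ d.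
  have : odd (3 ^ d.+1) by rewrite oddX orbT.
  by rewrite hs expnS; lia.
have {hs} s4 : 4 <= s by lia.
have s0 : 0 < s by lia.
have {link} [X dX DX] := link i j (introN eqP nij).
have := dD i; have := dD j; move: DX (dX).
move: (D i) (D j) spi spj => {nij i j dD} D1 D2 sp1 sp2.
have -> : 3 ^ (2 * d) = (3 ^ d) ^ 2 by rewrite -expnM mulnC.
set k := 3 ^ d * _; set lam := 3 ^ d * (_ - _).
move=> DX {}dX dD2 dD1.
have [E [H [g [i1 [[sEZ oE iE Gg gP] [injH HP D1E]]]]]] := spence_typeP s0 sp1.
have [E' [H' [g' [i2 [[sE'Z oE' _ Gg' _] [injH' HP' D2E]]]]]] :=
  spence_typeP s0 sp2.
(* 2s + 1 = 3q shows that 3 does not divide s. *)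
have eE : E' = E.
  by apply: (@central_Hall_uniq _ G E E' 3 d.+1 s); rewrite ?expnS //; lia.
move: oE' HP' D2E sE'Z; rewrite {}eE => _ HP' D2E _.
have HH' a : exists b, H b = H' a by apply/HP/HP'; exists a.
have [i3 [r]] := spence_sum_relabel E i2 g' injH' HH'.
rewrite -D2E => {}D2E.
have sHE a : H a \subset E by have /HP[] : exists b, H b = H a by exists a.
have oH a : #|H a| = 3 ^ d by have /HP[] : exists b, H b = H a by exists a.
have Gg'r a : (g' \o r) a \in G by apply: Gg'.
have [oG sD1G oD1 _ _] := dD1; have [_ sD2G oD2 _ _] := dD2.
have [_ sXG oX _ _] := dX.
have D1F := netF_spence oE sHE oH D1E.
have D2F := netF_spence oE sHE oH D2E.
have XF := net_comb_spence_mulV sEZ oE sHE oH injH sD1G sD2G Gg'r D1F D2F.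
have sumT := net_sum sEZ oE sHE oH injH dD1 Gg D1F.
pose c a := (net_sign i1 a * net_sign i3 a)%R.
pose u a := (g a * (g' (r a))^-1)%g.
have {D1F D2F}XF : (netF E (3 ^ d) * zgring_set X *~ (mu - nu) =
    net_comb E H c u *~ ((3 ^ d)%:Z ^+ 2))%R.
  rewrite -XF DX GRing.mulrDr !mulrzAr (netF_G sEZ oE).
  by rewrite mul0rz GRing.addr0.
have c2 a : (c a * c a = 1)%R.
  by rewrite /c GRing.mulrACA !net_sign_sqr GRing.mulr1.
have Gu a : u a \in G by rewrite groupM ?groupV //; apply: Gg'.
have m2 := linking_coef_sqr sEZ oE sHE oH injH dX Gu c2 sumT XF.
have kE := linking_augmentation sD1G sD2G sXG oD1 oD2 oX DX.
have mE : (mu - nu = (3 ^ d)%N)%R.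
  move/eqP: m2; rewrite GRing.eqf_sqr => /orP[/eqP-> //|/eqP mN].
  by case: (@linking_coef_neq_opp (3 ^ d) s nu s4 s2); rewrite -mN -expnS -oG.
have {}XF : (netF E (3 ^ d) * zgring_set X = net_comb E H c u *~ (3 ^ d)%N)%R.
  apply: (@zgring_mulrzI _ (3 ^ d)%N); first by lia.
  by rewrite -mulrzA -GRing.expr2 -XF mE.
have [t] := transversal_sum_netF sEZ oE gP sXG Gu XF.
have [t' t01 ->] := sum_net_sign i1 i3.
rewrite oX card_ord /k => kE'.
have : ((s + 1)%N%:Z = s%:Z - 4 * t' + 3 * t)%R.
  have q0 : ((3 ^ d)%N%:Z != 0)%R by lia.
  by apply: (GRing.mulfI q0); rewrite -PoszM.
by case: t01 => ->; lia.
Qed.
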